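(* Let $n,m,k$ be positive integers, let $X\in\mathbb{C}^{n\times n}$ be Hermitian, let $\Lambda:\mathbb{C}^{n\times n}\to\mathbb{C}^{m\times m}$ be a linear map and $Y\in\mathbb{C}^{m\times m}$. Let $\xi$ be the optimal value of \[ \max_{\rho\in\mathbb{C}^{n\times n}}\ \operatorname{Tr}(X\rho)\quad\text{s.t.}\quad \Lambda(\rho)=Y,\ \operatorname{Tr}(\rho)=1,\ \rho\ge 0,\ \operatorname{rank}(\rho)\le k . \] For a positive integer $N$, let $\mathcal{H}_A=\mathcal{H}_B=\cdots=\mathcal{H}_Z=\mathbb{C}^n\otimes\mathbb{C}^k$ be $N$ copies (parties $A,B,\dots,Z$), let $\widetilde{X}=X\otimes\mathbb{1}_k$, $\widetilde{\Lambda}(\cdot)=\Lambda[\operatorname{Tr}_2(\cdot)]$ with $\operatorname{Tr}_2$ the partial trace over $\mathbb{C}^k$, and let $\xi_N$ be the optimal value of the semidefinite program \[ \max_{\Phi_{AB\cdots Z}}\ \operatorname{Tr}\big[(\widetilde{X}_A\otimes\mathbb{1}_{B\cdots Z})\Phi_{AB\cdots Z}\big]\quad\text{s.t.}\quad \Phi_{AB\cdots Z}\ge0,\ \operatorname{Tr}(\Phi_{AB\cdots Z})=1,\ P_N^+\Phi_{AB\cdots Z}P_N^+=\Phi_{AB\cdots Z}, \] \[ (\widetilde{\Lambda}_A\otimes\mathrm{id}_{B\cdots Z})(\Phi_{AB\cdots Z})=Y\otimes\operatorname{Tr}_A(\Phi_{AB\cdots Z}). \] Then $\xi\le\xi_N$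 for every $N$, and moreover $\xi_{N+1}\le\xi_N$ for all $N$ and $\lim_{N\to+\infty}\xi_N=\xi$.
   Context: $\Phi_{AB\cdots Z}$ ranges over complex Hermitian operators on $\mathcal{H}_A\otimes\cdots\otimes\mathcal{H}_Z=(\mathbb{C}^n\otimes\mathbb{C}^k)^{\otimes N}$. $P_N^+=\frac{1}{N!}\sum_{\sigma\in S_N}V_\sigma$ is the orthogonal projector onto the symmetric subspace of $(\mathbb{C}^n\otimes\mathbb{C}^k)^{\otimes N}$, where $V_\sigma$ permutes the $N$ tensor factors according to $\sigma\in S_N$. A subscript $A$ indicates action on the first party; $\mathrm{id}_{B\cdots Z}$ is the identity map on operators of the remaining $N-1$ parties; $\operatorname{Tr}_A$ is the partial trace over the first party. *)

(* Defs.v *)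
From HB Require Import structures.
From mathcomp Require Import all_boot all_order all_algebra all_fingroup.
From mathcomp Require Import complex.
From mathcomp Require Import all_classical all_reals all_analysis.
Set Implicit Arguments. Unset Strict Implicit. Unset Printing Implicit Defensive.
Import Order.TTheory GRing.Theory Num.Theory.
Local Open Scope ring_scope.
Local Open Scope complex_scope.

Section Defs.
Variable R : realType.
Local Notation C := R[i].

Definition ctrmx (p q : nat) (A : 'M[C]_(p, q)) : 'M[C]_(q, p) := map_mx Num.conj A^T.

Definition herm (d : nat) (A : 'M[C]_d) : Prop := ctrmx A = A.

Definition psd (d : nat) (A : 'M[C]_d) : Prop :=
  herm A /\ forall v : 'cV[C]_d, 0 <= (ctrmx v *m A *m v) 0 0.

(* Operators on C^T for a finite index type T are #|T| x #|T| matrices,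
   indexed through enum_rank. *)
Definition opm (T : finType) (f : T -> T -> C) : 'M[C]_#|T| :=
  \matrix_(i, j) f (enum_val i) (enum_val j).
Definition ope (T : finType) (A : 'M[C]_#|T|) (x y : T) : C :=
  A (enum_rank x) (enum_rank y).

Definition feasible (n m k : nat) (Lam : {linear 'M[C]_n -> 'M[C]_m})
  (Y : 'M[C]_m) (rho : 'M[C]_n) : Prop :=
  [/\ Lam rho = Y, \tr rho = 1, psd rho & (\rank rho <= k)%N].

(* xi : the optimal value (supremum; -oo if infeasible) *)
Definition xi (n m k : nat) (X : 'M[C]_n) (Lam : {linear 'M[C]_n -> 'M[C]_m})
  (Y : 'M[C]_m) : \bar R :=
  ereal_sup [set ((complex.Re (\tr (X *m rho)))%:E) | rho in @feasible n m k Lam Y].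

(* single party H = C^n (x) C^k, basis indexed by 'I_n * 'I_k *)
Notation party n k := ('I_n * 'I_k)%type.

(* N.+1 parties A,B,...: basis of H^(x)(N+1) indexed by ffun 'I_N.+1 -> party;
   party A is ord0, the remaining parties B..Z are indexed by 'I_N. *)
Notation allP n k N := {ffun 'I_N.+1 -> party n k}.
Notation restP n k N := {ffun 'I_N -> party n k}.

Definition pcons (n k N : nat) (s : party n k) (y : restP n k N) : allP n k N :=
  [ffun i : 'I_N.+1 => if unlift ord0 i is Some j then y j else s].

Definition Xt (n k : nat) (X : 'M[C]_n) : 'M[C]_#|{: party n k}| :=
  opm (fun s s' : party n k => X s.1 s'.1 * (s.2 == s'.2)%:R).

Definition tr2 (n k : nat) (M : 'M[C]_#|{: party n k}|) : 'M[C]_n :=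
  \matrix_(a, a') \sum_(b : 'I_k) ope M (a, b) (a', b).

Definition Lamt (n m k : nat) (Lam : {linear 'M[C]_n -> 'M[C]_m})
  (M : 'M[C]_#|{: party n k}|) : 'M[C]_m := Lam (tr2 M).

Definition XA (n k N : nat) (X : 'M[C]_n) : 'M[C]_#|{: allP n k N}| :=
  opm (fun x x' : allP n k N =>
    ope (Xt k X) (x ord0) (x' ord0) *
    [forall j : 'I_N, x (lift ord0 j) == x' (lift ord0 j)]%:R).

Definition trA (n k N : nat) (Phi : 'M[C]_#|{: allP n k N}|) : 'M[C]_#|{: restP n k N}| :=
  opm (fun y y' : restP n k N =>
    \sum_(s : party n k) ope Phi (pcons s y) (pcons s y')).

Definition LamA (n m k N : nat) (Lam : {linear 'M[C]_n -> 'M[C]_m})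
  (Phi : 'M[C]_#|{: allP n k N}|) : 'M[C]_#|{: 'I_m * restP n k N}| :=
  opm (fun (iy iy' : ('I_m * restP n k N)%type) =>
    Lamt Lam (opm (fun s s' : party n k => ope Phi (pcons s iy.2) (pcons s' iy'.2)))
      iy.1 iy'.1).

Definition kronY (m : nat) (T : finType) (Y : 'M[C]_m) (M : 'M[C]_#|T|) :
  'M[C]_#|{: 'I_m * T}| :=
  opm (fun (iy iy' : ('I_m * T)%type) => Y iy.1 iy'.1 * ope M iy.2 iy'.2).

Definition Vperm (n k N : nat) (s : 'S_N.+1) : 'M[C]_#|{: allP n k N}| :=
  opm (fun x y : allP n k N => (x == [ffun i => y (s i)])%:R).
Definition Psym (n k N : nat) : 'M[C]_#|{: allP n k N}| :=
  (N.+1)`!%:R^-1 *: \sum_(s : 'S_N.+1) Vperm n k s.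

Definition sdp_feasible (n m k N : nat) (Lam : {linear 'M[C]_n -> 'M[C]_m})
  (Y : 'M[C]_m) (Phi : 'M[C]_#|{: allP n k N}|) : Prop :=
  [/\ psd Phi, \tr Phi = 1, Psym n k N *m Phi *m Psym n k N = Phi
    & LamA Lam Phi = kronY Y (trA Phi)].

(* xi_hier N = xi_{N+1}, the value of the SDP with N+1 parties *)
Definition xi_hier (n m k : nat) (X : 'M[C]_n) (Lam : {linear 'M[C]_n -> 'M[C]_m})
  (Y : 'M[C]_m) (N : nat) : \bar R :=
  ereal_sup [set ((complex.Re (\tr (@XA n k N X *m Phi)))%:E)
            | Phi in @sdp_feasible n m k N Lam Y].

End Defs.

(* Main.v *)
Require Import Defs.
From HB Require Import structures.
From mathcomp Require Import all_boot all_order all_algebra all_fingroup.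
From mathcomp Require Import complex.
From mathcomp Require Import all_classical all_reals all_analysis.
From mathcomp Require Import ring.
Import Order.TTheory GRing.Theory Num.Theory.
Import numFieldNormedType.Exports.
Set Implicit Arguments. Unset Strict Implicit.
Unset Printing Implicit Defensive.
Local Open Scope ring_scope.
Local Open Scope classical_set_scope.

(** A conditioning proof of the bosonic quantum de Finetti theorem, without
    integration. Contract one party of a symmetric [Phi] with each vector of
    the tight frame [polar_vec]; this preserves all constraints, which are
    homogeneous, and writes the first marginal [rho] of [Phi] as a mixture
    of the marginals [r b] of the contracted operators. The purity
    [tr (rho^2) / tr rho] is a bounded submartingale along such contractions.
    When its mean increment is small the first party is almost independent
    of the contracted one; as swapping the two acts trivially, the first
    marginal is then almost pure. Hence the first marginal of a feasible
    [Phi] on [N] parties is a mixture of states [s] which, once normalised,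
    satisfy [Lam (tr2 s) = Y] exactly, and whose total linear entropy is at
    most [e] plus a term [O(1/(e N))], for every [e > 0]. By compactness the
    objective of such a state exceeds any [t > xi] by at most a constant
    times its linear entropy, because a pure state has a feasible partial
    trace. Conversely a feasible [rho = B B^*] is the partial trace of the
    pure state with amplitudes [B], whose tensor powers are feasible at
    every level. *)

Lemma sum_sqr_eq1_delta (F : numDomainType) (I : finType) (s : I -> F) :
  (forall i, 0 <= s i) -> \sum_i s i = 1 -> \sum_i s i * s i = 1 ->
  exists i, s =1 fun j => (j == i)%:R.
Proof.
move=> s0 s1 ss1.
have le1 i : s i <= 1 by rewrite -s1 (bigD1 i)//= lerDl sumr_ge0.
have /psumr_eq0P s01 : \sum_i s i * (1 - s i) = 0.
  by under eq_bigr do rewrite mulrBr mulr1; rewrite sumrB s1 ss1 subrr.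
have {}s01 i : s i = 0 \/ s i = 1.
  have term_ge0 j : true -> 0 <= s j * (1 - s j).
    by move=> _; rewrite mulr_ge0 ?subr_ge0.
  have /eqP := s01 term_ge0 i isT.
  by rewrite mulf_eq0 subr_eq0 => /orP[/eqP|/eqP]; [left|right].
have [i si] : exists i, s i = 1.
  apply/not_existsP => n1; have := oner_neq0 F; rewrite -s1 big1 ?eqxx// => i _.
  by case: (s01 i) => [//|/n1 []].
exists i => j; have [->//|ji] := eqVneq j i.
move: s1; rewrite (bigD1 i)//= si -[RHS]addr0 => /addrI /psumr_eq0P; exact.
Qed.

Section PsdMatrices.
Variable R : realType.
Local Notation C := R[i].

Lemma ctrmxE p q (A : 'M[C]_(p, q)) i j : ctrmx A i j = (A j i)^*.
Proof. by rewrite !mxE. Qed.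

Lemma ctrmxK p q (A : 'M[C]_(p, q)) : ctrmx (ctrmx A) = A.
Proof. exact: trmxCK. Qed.

Lemma ctrmxM p q r (A : 'M[C]_(p, q)) (B : 'M[C]_(q, r)) :
  ctrmx (A *m B) = ctrmx B *m ctrmx A.
Proof. by rewrite /ctrmx trmx_mul map_mxM. Qed.

Lemma ctrmxD p q (A B : 'M[C]_(p, q)) : ctrmx (A + B) = ctrmx A + ctrmx B.
Proof. by rewrite /ctrmx linearD /= map_mxD. Qed.

Lemma ctrmxZ p q a (A : 'M[C]_(p, q)) : ctrmx (a *: A) = a^* *: ctrmx A.
Proof. by rewrite /ctrmx linearZ /= map_mxZ. Qed.

Lemma mulmx_ctrmxE p q r (A : 'M[C]_(p, q)) (B : 'M[C]_(r, q)) i j :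
  (A *m ctrmx B) i j = \sum_l A i l * (B j l)^*.
Proof. by rewrite mxE; apply: eq_bigr => l _; rewrite ctrmxE. Qed.

Lemma hermE d (A : 'M[C]_d) : herm A -> forall i j, (A i j)^* = A j i.
Proof. by move=> hA i j; rewrite -[in RHS]hA ctrmxE. Qed.

Definition qform d (A : 'M[C]_d) (v : 'cV[C]_d) : C := (ctrmx v *m A *m v) 0 0.

Lemma qformE d (A : 'M[C]_d) v :
  qform A v = \sum_i \sum_j (v i 0)^* * A i j * v j 0.
Proof.
rewrite /qform mxE exchange_big; apply: eq_bigr => j _ /=.
by rewrite mxE mulr_suml; apply: eq_bigr => i _; rewrite ctrmxE.
Qed.

Lemma qformD d (A B : 'M[C]_d) v : qform (A + B) v = qform A v + qform B v.
Proof. by rewrite /qform mulmxDr mulmxDl mxE. Qed.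

Lemma qformZ d a (A : 'M[C]_d) v : qform (a *: A) v = a * qform A v.
Proof. by rewrite /qform -scalemxAr -scalemxAl mxE. Qed.

Lemma qform_sum d (I : finType) (F : I -> 'M[C]_d) v :
  qform (\sum_i F i) v = \sum_i qform (F i) v.
Proof. by rewrite /qform mulmx_sumr mulmx_suml summxE. Qed.

Lemma qform_delta d (A : 'M[C]_d) i : qform A (delta_mx i 0) = A i i.
Proof.
by rewrite /qform /ctrmx trmx_delta map_delta_mx -rowE -colE !mxE.
Qed.

Lemma psd_congr d e (A : 'M[C]_d) (W : 'M[C]_(d, e)) :
  psd A -> psd (ctrmx W *m A *m W).
Proof.
move=> [hA pA]; split=> [|v]; first by rewrite /herm !ctrmxM ctrmxK hA mulmxA.
by rewrite !mulmxA -ctrmxM -mulmxA.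
Qed.

Lemma psd_mxsub d e (f : 'I_e -> 'I_d) (A : 'M[C]_d) :
  psd A -> psd (mxsub f f A).
Proof.
have -> : mxsub f f A = ctrmx (colsub f 1%:M) *m A *m colsub f 1%:M.
  rewrite /ctrmx trmx_mxsub map_mxsub trmx1 map_mx1 mul_rowsub_mx mul1mx.
  by rewrite mulmx_colsub mulmx1; apply/matrixP => i j; rewrite !mxE.
exact: psd_congr.
Qed.

Lemma psd_mulctrmx d e (B : 'M[C]_(d, e)) : psd (B *m ctrmx B).
Proof.
split=> [|v]; first by rewrite /herm ctrmxM ctrmxK.
rewrite mulmxA -{1}[B]ctrmxK -ctrmxM -mulmxA mxE.
by apply: sumr_ge0 => i _; rewrite ctrmxE mulrC mul_conjC_ge0.
Qed.

Lemma psd0 d : psd (0 : 'M[C]_d).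
Proof.
by split=> [|v]; rewrite ?mulmx0 ?mul0mx ?mxE // /herm /ctrmx trmx0 map_mx0.
Qed.

Lemma psdD d (A B : 'M[C]_d) : psd A -> psd B -> psd (A + B).
Proof.
move=> [hA pA] [hB pB]; split=> [|v]; first by rewrite /herm ctrmxD hA hB.
by rewrite -/(qform _ _) qformD addr_ge0 ?pA ?pB.
Qed.

Lemma psdZ d a (A : 'M[C]_d) : 0 <= a -> psd A -> psd (a *: A).
Proof.
move=> a0 [hA pA]; split=> [|v].
  by rewrite /herm ctrmxZ hA geC0_conj.
by rewrite -/(qform _ _) qformZ mulr_ge0 ?pA.
Qed.

Lemma psd_sum d (I : Type) (r : seq I) (F : I -> 'M[C]_d) :
  (forall i, psd (F i)) -> psd (\sum_(i <- r) F i).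
Proof.
move=> pF; elim/big_ind: _ => // [|A B]; [exact: psd0|exact: psdD].
Qed.

Lemma psd_mxtrace_ge0 d (A : 'M[C]_d) : psd A -> 0 <= \tr A.
Proof.
by move=> [_ pA]; apply: sumr_ge0 => i _; rewrite -qform_delta; exact: pA.
Qed.

Lemma psd_spectral d (A : 'M[C]_d) : psd A ->
  exists (P : 'M[C]_d) (s : 'rV[C]_d),
  [/\ P \is unitarymx, forall i, 0 <= s 0 i & A = ctrmx P *m diag_mx s *m P].
Proof.
move=> [hA pA]; pose P := spectralmx A; pose s := spectral_diag A.
have uP : P \is unitarymx by exact: spectral_unitarymx.
have AE : A = ctrmx P *m diag_mx s *m P.
  rewrite -[ctrmx P]invmx_unitary//; apply/orthomx_spectralP/normalmxP.
  by rewrite -/(ctrmx A) hA.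
exists P, s; split=> // i.
have := pA (ctrmx P *m delta_mx i 0); rewrite AE ctrmxM ctrmxK.
have PP : P *m ctrmx P = 1%:M by exact/unitarymxP.
have -> (v : 'cV[C]_d) :
    ctrmx v *m P *m (ctrmx P *m diag_mx s *m P) *m (ctrmx P *m v) =
    ctrmx v *m diag_mx s *m v.
  by rewrite !mulmxA -(mulmxA _ P) PP mulmx1 -(mulmxA _ P) PP mulmx1.
by rewrite -/(qform _ _) qform_delta mxE eqxx mulr1n.
Qed.

Lemma unitarymx_diagM d (P : 'M[C]_d) (s t : 'rV[C]_d) : P \is unitarymx ->
  (ctrmx P *m diag_mx s *m P) *m (ctrmx P *m diag_mx t *m P) =
  ctrmx P *m diag_mx (\row_i (s 0 i * t 0 i)) *m P.
Proof.
move=> uP; rewrite !mulmxA -(mulmxA _ P) [P *m ctrmx P](unitarymxP uP) mulmx1.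
by rewrite -(mulmxA _ (diag_mx s)) mulmx_diag.
Qed.

Lemma mxtrace_unitarymx_diag d (P : 'M[C]_d) (s : 'rV[C]_d) : P \is unitarymx ->
  \tr (ctrmx P *m diag_mx s *m P) = \sum_i s 0 i.
Proof.
move=> uP; rewrite mxtrace_mulC mulmxA [P *m ctrmx P](unitarymxP uP).
by rewrite mul1mx mxtrace_diag.
Qed.

Lemma psd_mxtrace_eq0 d (A : 'M[C]_d) : psd A -> \tr A = 0 -> A = 0.
Proof.
move=> /psd_spectral[P [s [uP s0 ->]]]; rewrite mxtrace_unitarymx_diag// => trs.
have -> : s = 0.
  by apply/rowP => i; rewrite mxE; exact: (psumr_eq0P (fun j _ => s0 j) trs).
by rewrite linear0 mulmx0 mul0mx.
Qed.

Lemma psd_mxtrace_sqr_le d (A : 'M[C]_d) : psd A -> \tr (A *m A) <= \tr A ^+ 2.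
Proof.
move=> /psd_spectral[P [s [uP s0 ->]]]; rewrite unitarymx_diagM//.
rewrite !mxtrace_unitarymx_diag// expr2 mulr_suml; apply: ler_sum => i _.
by rewrite mxE ler_wpM2l// (bigD1 i)//= lerDl sumr_ge0.
Qed.

Lemma pure_rank1 d (A : 'M[C]_d) : psd A -> \tr A = 1 -> \tr (A *m A) = 1 ->
  exists v : 'cV[C]_d, A = v *m ctrmx v.
Proof.
move=> /psd_spectral[P [s [uP s0 ->]]]; rewrite unitarymx_diagM//.
rewrite !mxtrace_unitarymx_diag// => s1; under eq_bigr do rewrite mxE.
move=> /(sum_sqr_eq1_delta s0 s1)[i si]; exists (ctrmx P *m delta_mx i 0).
have -> : diag_mx s = delta_mx i 0 *m ctrmx (delta_mx i 0 : 'cV[C]_d).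
  rewrite /ctrmx trmx_delta map_delta_mx mul_delta_mx.
  apply/matrixP => j l; rewrite !mxE si; case: (eqVneq j l) => [->|jl].
    by rewrite andbb mulr1n.
  by rewrite mulr0n; case: (eqVneq j i) jl => // ->;
    rewrite eq_sym => /negbTE ->.
by rewrite ctrmxM ctrmxK !mulmxA.
Qed.

Lemma psd_factor d (A : 'M[C]_d) :
  psd A -> exists B : 'M[C]_d, A = B *m ctrmx B.
Proof.
move=> /psd_spectral[P [s [uP s0 ->]]].
pose q : 'rV[C]_d := \row_i sqrtC (s 0 i).
exists (ctrmx P *m diag_mx q); rewrite ctrmxM ctrmxK mulmxA.
rewrite /ctrmx tr_diag_mx map_diag_mx -!(mulmxA _ _ P) -(mulmxA _ (diag_mx q)).
rewrite [diag_mx q *m _]mulmxA mulmx_diag; congr (_ *m (diag_mx _ *m _)).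
apply/rowP => i; rewrite !mxE /= geC0_conj ?sqrtC_ge0//.
by rewrite -expr2 sqrtCK.
Qed.

Lemma orthonormal_row_basis p d (A : 'M[C]_(p, d)) :
  exists2 Q : 'M[C]_(\rank A, d), Q *m ctrmx Q = 1%:M & A *m ctrmx Q *m Q = A.
Proof.
have QQ : schmidt (row_base A) *m ctrmx (schmidt (row_base A)) = 1%:M.
  by apply/unitarymxP/schmidt_unitarymx; exact: rank_leq_col.
exists (schmidt (row_base A)) => //.
move: (schmidt _) QQ (schmidt_sub (row_base A)) => Q QQ.
rewrite (eq_row_base A); move: (\rank A) Q QQ => r Q QQ /submxP[Z ->].
by rewrite -(mulmxA Z) QQ mulmx1.
Qed.

(* With [Q] an orthonormal basis of the row space of [A], [A = Q^* (Q A Q^* ) Q]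
   and the compression [Q A Q^*] has size [\rank A]. *)
Lemma psd_rank_factor k d (A : 'M[C]_d) : psd A -> (\rank A <= k)%N ->
  exists B : 'M[C]_(d, k), A = B *m ctrmx B.
Proof.
move=> pA; have [Q QQ AQ] := orthonormal_row_basis A; have [hA _] := pA.
move: (\rank A) Q QQ AQ => r Q QQ AQ rk.
have QA : ctrmx Q *m Q *m A = A.
  by have /(congr1 (@ctrmx _ _ _)) := AQ; rewrite !ctrmxM ctrmxK hA mulmxA.
have := psd_congr (ctrmx Q) pA; rewrite ctrmxK => /psd_factor[B BE].
exists (ctrmx Q *m B *m pid_mx r).
have ct_pid : ctrmx (pid_mx r : 'M[C]_(r, k)) = pid_mx r.
  by rewrite /ctrmx tr_pid_mx map_pid_mx.
rewrite ctrmxM ct_pid -mulmxA [pid_mx _ *m _]mulmxA mul_pid_mx minnn.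
rewrite (minn_idPr rk) pid_mx_1 mul1mx.
by rewrite ctrmxM ctrmxK !mulmxA -(mulmxA _ B) -BE !mulmxA QA AQ.
Qed.

End PsdMatrices.

Lemma normr_le_AGM2 (F : numFieldType) (w q x a : F) :
  0 < a -> 0 <= q -> (q = 0 -> w = 0) ->
  `|w| ^+ 2 <= x -> `|w| <= a * q + x / q / (4%:R * a).
Proof.
move=> a0; rewrite le_eqVlt => /predU1P[<- /(_ erefl) -> _|q0 _ wx].
  by rewrite normr0 invr0 !mulr0 mul0r addr0.
have den0 : 0 < 4%:R * a * q by rewrite !mulr_gt0.
have -> : a * q + x / q / (4%:R * a) =
    (4%:R * (a * q) ^+ 2 + x) / (4%:R * a * q).
  by field; rewrite !lt0r_neq0.
rewrite ler_pdivlMr//.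
apply: le_trans (_ : _ <= 4%:R * (a * q) ^+ 2 + `|w| ^+ 2) _.
  rewrite -subr_ge0.
  have -> : 4%:R * (a * q) ^+ 2 + `|w| ^+ 2 - `|w| * (4%:R * a * q) =
    (`|w| - 2%:R * a * q) ^+ 2 by ring.
  rewrite real_exprn_even_ge0// rpredB ?normr_real//.
  by rewrite !realM ?realn// gtr0_real.
by rewrite lerD2l.
Qed.

Lemma sum_expi4 (C : numClosedFieldType) (F : C -> C) :
  \sum_(t < 4) F ('i ^+ t) = F 1 + F 'i + F (-1) + F (- 'i).
Proof.
rewrite !big_ord_recl big_ord0 /= /bump /= !addr0 expr0 expr1 !addrA.
have i2 : 'i ^+ (1 + 1) = -1 :> C by exact: sqrCi.
have i3 : 'i ^+ (1 + (1 + 1)) = - 'i :> C by rewrite exprD sqrCi expr1 mulrN1.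
by rewrite i2 i3.
Qed.

Lemma norm_conj_expi (C : numClosedFieldType) t : `|('i ^+ t)^*| = 1 :> C.
Proof. by rewrite norm_conjC normrX normCi expr1n. Qed.

Section Purity.
Variable R : realType.
Local Notation C := R[i].

(* Both vanish when [\tr A = 0], by the convention [x / 0 = 0]; they are
   homogeneous of degree one, hence adapted to unnormalised states. *)
Definition purity d (A : 'M[C]_d) : C := \tr (A *m A) / \tr A.

Definition linear_entropy d (A : 'M[C]_d) : C := \tr A - purity A.

Lemma purityZ d a (A : 'M[C]_d) : purity (a *: A) = a * purity A.
Proof.
have [->|a0] := eqVneq a 0.
  by rewrite /purity scale0r mul0mx mxtrace0 !mul0r.
rewrite /purity -scalemxAl -scalemxAr !mxtraceZ invfM.
by move: (\tr A)^-1 => p; field.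
Qed.

Lemma linear_entropyZ d a (A : 'M[C]_d) :
  linear_entropy (a *: A) = a * linear_entropy A.
Proof. by rewrite /linear_entropy purityZ mxtraceZ mulrBr. Qed.

Lemma linear_entropy_normalized d (A : 'M[C]_d) :
  \tr A = 1 -> linear_entropy A = 1 - \tr (A *m A).
Proof. by move=> tr1; rewrite /linear_entropy /purity tr1 divr1. Qed.

Lemma linear_entropy_ge0 d (A : 'M[C]_d) : psd A -> 0 <= linear_entropy A.
Proof.
move=> pA; rewrite subr_ge0 /purity.
have := psd_mxtrace_ge0 pA; rewrite le_eqVlt => /predU1P[<-|t0].
  by rewrite invr0 mulr0.
by rewrite ler_pdivrMr// -expr2 psd_mxtrace_sqr_le.
Qed.

Lemma herm_mxtrace_sqr d (A : 'M[C]_d) : herm A ->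
  \tr (A *m A) = \sum_i \sum_j `|A i j| ^+ 2.
Proof.
move=> hA; rewrite -{2}hA; apply: eq_bigr => i _; rewrite mulmx_ctrmxE.
by apply: eq_bigr => j _; rewrite normCK.
Qed.

Lemma herm_entry_sqr_le d (A : 'M[C]_d) i j :
  herm A -> `|A i j| ^+ 2 <= \tr (A *m A).
Proof.
have sqr_norm_ge0 (z : C) : 0 <= `|z| ^+ 2 by rewrite exprn_ge0.
move=> /herm_mxtrace_sqr ->; rewrite (bigD1 i)//= (bigD1 j)//= -addrA lerDl.
by rewrite addr_ge0 ?sumr_ge0// => l _; rewrite sumr_ge0.
Qed.

Lemma purity_ge0 d (A : 'M[C]_d) : psd A -> 0 <= purity A.
Proof.
move=> pA; have [hA _] := pA; rewrite divr_ge0 ?psd_mxtrace_ge0//.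
by rewrite -{2}hA; exact: psd_mulctrmx.
Qed.

Definition deviation d (rho r : 'M[C]_d) : 'M[C]_d :=
  r - (\tr r / \tr rho) *: rho.

Lemma herm_deviation d (rho r : 'M[C]_d) :
  psd rho -> psd r -> herm (deviation rho r).
Proof.
move=> prho pr; have [hrho _] := prho; have [hr _] := pr.
rewrite /herm /deviation -scaleN1r !ctrmxD !ctrmxZ hr hrho rmorphN rmorph1.
by rewrite geC0_conj// divr_ge0// psd_mxtrace_ge0.
Qed.

Lemma deviation_eq0 d (rho r : 'M[C]_d) :
  psd r -> \tr r = 0 -> deviation rho r = 0.
Proof.
move=> pr /(psd_mxtrace_eq0 pr) ->.
by rewrite /deviation mxtrace0 mul0r scale0r subr0.
Qed.

Lemma mxtrace_sqr_deviation d (rho r : 'M[C]_d) : psd r ->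
  \tr (deviation rho r *m deviation rho r) / \tr r =
  purity r - \tr (r *m rho) / \tr rho *+ 2 + \tr r * purity rho / \tr rho.
Proof.
move=> pr; have [t0|t0] := eqVneq (\tr r) 0.
  have r0 := psd_mxtrace_eq0 pr t0.
  rewrite /purity t0 r0 !mul0mx mxtrace0 invr0 !mul0r.
  by rewrite mulr0 mul0rn subr0 addr0.
rewrite /deviation /purity mulmxBl !mulmxBr -!scalemxAl -!scalemxAr.
rewrite !raddfB /= !mxtraceZ (mxtrace_mulC rho r).
by move: (\tr rho)^-1 => p; field.
Qed.

Lemma purity_total_variance d (I : finType) (rho : 'M[C]_d)
    (r : I -> 'M[C]_d) D :
  (forall b, psd (r b)) -> \sum_b r b = D *: rho ->
  \sum_b \tr (deviation rho (r b) *m deviation rho (r b)) / \tr (r b) =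
  \sum_b purity (r b) - D * purity rho.
Proof.
move=> pr sumr; under eq_bigr do rewrite mxtrace_sqr_deviation//.
have sum_tr : \sum_b \tr (r b) = D * \tr rho.
  by rewrite -raddf_sum /= sumr mxtraceZ.
have sum_tr_mul : \sum_b \tr (r b *m rho) = D * \tr (rho *m rho).
  by rewrite -raddf_sum /= -mulmx_suml sumr -scalemxAl mxtraceZ.
rewrite big_split sumrB /= sumrMnl -!mulr_suml sum_tr sum_tr_mul /purity.
have [->|t0] := eqVneq (\tr rho) 0; last by field.
by rewrite invr0 !mulr0 mul0rn !subr0 addr0.
Qed.

End Purity.

Notation polar_index d := ('I_d * 'I_d * 'I_4)%type.

Section Polarization.
Variables (R : realType) (d : nat).
Local Notation C := R[i].

(* [\sum_b v_b v_b^* = frame_bound *: 1] for [v_b := polar_vec b]. *)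
Definition frame_bound : C := (8 * d)%:R.

Lemma frame_bound_gt0 : (0 < d)%N -> 0 < frame_bound.
Proof. by move=> d0; rewrite ltr0n muln_gt0. Qed.

(* [frame_bound / (16 * a)] for the parameter [a := 4 * e / frame_bound] of
   [linear_entropy_le_variance]. *)
Definition gain_weight (e : C) : C := frame_bound ^+ 2 / (64%:R * e).

Lemma gain_weight_ge0 e : 0 < e -> 0 <= gain_weight e.
Proof. by move=> e0; rewrite divr_ge0 ?exprn_ge0 ?mulr_ge0 ?ler0n ?ltW. Qed.

Definition polar_vec (b : polar_index d) : 'cV[C]_d :=
  delta_mx b.1.1 0 + 'i ^+ b.2 *: delta_mx b.1.2 0.

Lemma qform_polar_vec (A : 'M[C]_d) i j (t : 'I_4) (u : C := 'i ^+ t) :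
  qform A (polar_vec (i, j, t)) =
  A i i + u * A i j + u^* * A j i + u^* * u * A j j.
Proof.
rewrite /qform /polar_vec ctrmxD ctrmxZ /ctrmx !trmx_delta !map_delta_mx /=.
rewrite !mulmxDl !mulmxDr -!scalemxAl -!scalemxAr -!rowE -!colE !mxE -/u; ring.
Qed.

Lemma polarization (A : 'M[C]_d) i j :
  \sum_(t < 4) ('i ^+ t)^* * qform A (polar_vec (i, j, t)) = 4%:R * A i j.
Proof.
under eq_bigr do rewrite qform_polar_vec.
rewrite (sum_expi4 (fun u =>
  u^* * (A i i + u * A i j + u^* * A j i + u^* * u * A j j))).
rewrite !rmorphN !rmorph1 /= conjCi.
have ii : 'i * 'i = -1 :> C by exact: sqrCi.
by ring: ii.
Qed.

Definition polar_swap (r : polar_index d -> 'M[C]_d) : C :=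
  \sum_(b : polar_index d) ('i ^+ b.2)^* * r b b.1.2 b.1.1.

Lemma polar_swap_qform (A : 'I_d -> 'I_d -> 'M[C]_d) :
  polar_swap (fun b => \matrix_(i, j) qform (A i j) (polar_vec b)) =
  4%:R * \sum_i \sum_j A j i i j.
Proof.
rewrite /polar_swap; under eq_bigr do rewrite mxE.
rewrite -(pair_bigA _ (fun ij (t : 'I_4) =>
  ('i ^+ t)^* * qform (A ij.2 ij.1) (polar_vec (ij, t)))) /=.
rewrite [X in _ = _ * X]pair_bigA mulr_sumr.
by apply: eq_bigr => -[i j] _; exact: polarization.
Qed.

Lemma sum_qform_polar_vec (A : 'M[C]_d) :
  \sum_b qform A (polar_vec b) = frame_bound * \tr A.
Proof.
transitivity (\sum_(ij : 'I_d * 'I_d) 4%:R * (A ij.1 ij.1 + A ij.2 ij.2)).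
  rewrite -(pair_bigA _ (fun ij t => qform A (polar_vec (ij, t)))) /=.
  apply: eq_bigr => -[i j] _; under eq_bigr do rewrite qform_polar_vec.
  rewrite (sum_expi4 (fun u =>
    A i i + u * A i j + u^* * A j i + u^* * u * A j j)).
  rewrite !rmorphN !rmorph1 /= conjCi.
  have ii : 'i * 'i = -1 :> C by exact: sqrCi.
  by ring: ii.
rewrite -(pair_bigA _ (fun i j => 4%:R * (A i i + A j j))) /=.
under eq_bigr => i _ do rewrite -mulr_sumr big_split /= sumr_const card_ord.
rewrite -mulr_sumr big_split /= sumr_const card_ord sumrMnl -/(\tr A).
by rewrite -[\tr A *+ _]mulr_natl /frame_bound natrM; ring.
Qed.

(* The family [r] stands for the contractions of the second party of an operator
   [A] of [C^d (x) C^d], with first marginal [rho], by the [polar_vec]; by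
   [polar_swap_qform], [swap_r] then says that [\tr (F *m A) = \tr A] for the
   swap [F]. *)
Section SwapInvariantContractions.
Variables (rho : 'M[C]_d) (r : polar_index d -> 'M[C]_d).
Hypotheses (prho : psd rho) (pr : forall b, psd (r b)).
Hypothesis sum_r : \sum_b r b = frame_bound *: rho.
Hypothesis tr_r : forall b, \tr (r b) = qform rho (polar_vec b).
Hypothesis swap_r : polar_swap r = 4%:R * \tr rho.

Lemma linear_entropy_deviation :
  4%:R * linear_entropy rho = polar_swap (fun b => deviation rho (r b)).
Proof.
have swap_rho :
    polar_swap (fun b => \tr (r b) *: rho) = 4%:R * \tr (rho *m rho).
  transitivity (polar_swap (fun b =>
      \matrix_(i, j) qform (rho i j *: rho) (polar_vec b))).
    by apply: eq_bigr => b _; rewrite !mxE tr_r qformZ (mulrC (rho _ _)).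
  rewrite polar_swap_qform; congr (_ * _); apply: eq_bigr => i _; rewrite mxE.
  by apply: eq_bigr => j _; rewrite mxE mulrC.
rewrite /linear_entropy mulrBr -swap_r /purity mulrA -swap_rho mulr_suml -sumrB.
by apply: eq_bigr => b _; rewrite !mxE; ring.
Qed.

Lemma linear_entropy_le_variance a : 0 < a ->
  4%:R * linear_entropy rho <=
  a * (frame_bound * \tr rho) +
  (\sum_b purity (r b) - frame_bound * purity rho) / (4%:R * a).
Proof.
move=> a0; rewrite -[leLHS]ger0_norm ?mulr_ge0 ?linear_entropy_ge0//.
have entry_le (b : polar_index d) :
    `|('i ^+ b.2)^* * deviation rho (r b) b.1.2 b.1.1| <=
    a * \tr (r b) +
    \tr (deviation rho (r b) *m deviation rho (r b)) / \tr (r b) / (4%:R * a).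
  rewrite normrM norm_conj_expi mul1r; apply: normr_le_AGM2 => //.
  - exact: psd_mxtrace_ge0.
  - by move=> tr0; rewrite deviation_eq0// mxE.
  - by apply: herm_entry_sqr_le; exact: herm_deviation.
rewrite linear_entropy_deviation; apply: le_trans (ler_norm_sum _ _ _) _.
apply: le_trans (ler_sum _ (fun b _ => entry_le b)) _.
rewrite big_split /= -mulr_sumr -raddf_sum /= sum_r mxtraceZ -mulr_suml.
by rewrite (purity_total_variance pr sum_r).
Qed.

Lemma linear_entropy_le_purity_gain e : (0 < d)%N -> 0 < e ->
  linear_entropy rho <=
  e * \tr rho +
  gain_weight e * (frame_bound^-1 * (\sum_b purity (r b)) - purity rho).
Proof.
move=> d0 e0; have D0 := frame_bound_gt0 d0.
have a0 : 0 < 4%:R * e / frame_bound by rewrite divr_gt0// mulr_gt0.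
rewrite -(ler_pM2l (_ : 0 < 4%:R :> C))//.
apply: le_trans (linear_entropy_le_variance a0) _.
rewrite le_eqVlt; apply/predU1P; left.
by rewrite /gain_weight; field; rewrite pnatr_eq0 -lt0n d0 lt0r_neq0.
Qed.

End SwapInvariantContractions.

End Polarization.

Lemma sum_enum_rank (V : nmodType) (T : finType) (F : 'I_#|T| -> V) :
  \sum_i F i = \sum_x F (enum_rank x).
Proof. by rewrite (reindex _ (onW_bij _ (enum_rank_bij T))). Qed.

Lemma sum_mul_delta (A : pzSemiRingType) (T : finType) (a : T -> A) x :
  \sum_y a y * (y == x)%:R = a x.
Proof.
by rewrite (bigD1 x)//= eqxx mulr1 big1 ?addr0// => y /negbTE ->; rewrite mulr0.
Qed.

Section IndexedOperators.
Variables (R : realType) (T : finType).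
Local Notation C := R[i].
Implicit Types A B : 'M[C]_#|T|.

Lemma opmK (f : T -> T -> C) : ope (opm f) = f.
Proof. by apply/funext=> x; apply/funext=> y; rewrite /ope mxE !enum_rankK. Qed.

Lemma opeP A B : (forall x y, ope A x y = ope B x y) -> A = B.
Proof.
move=> AB; apply/matrixP => i j; have := AB (enum_val i) (enum_val j).
by rewrite /ope !enum_valK.
Qed.

Lemma ope_mul A B x y : ope (A *m B) x y = \sum_z ope A x z * ope B z y.
Proof. by rewrite /ope mxE sum_enum_rank. Qed.

Lemma mxtrace_ope A : \tr A = \sum_x ope A x x.
Proof. exact: sum_enum_rank. Qed.

Lemma ope_sum (I : Type) (r : seq I) (F : I -> 'M[C]_#|T|) x y :
  ope (\sum_(i <- r) F i) x y = \sum_(i <- r) ope (F i) x y.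
Proof. by rewrite /ope summxE. Qed.

Lemma opeZ a A x y : ope (a *: A) x y = a * ope A x y.
Proof. by rewrite /ope mxE. Qed.

End IndexedOperators.

Section PartialTrace.
Variables (R : realType) (n k : nat).
Local Notation C := R[i].
Local Notation P := ('I_n * 'I_k)%type.

Lemma tr2_is_linear : linear (@tr2 R n k).
Proof.
move=> a A B; apply/matrixP => i j; rewrite !mxE mulr_sumr -big_split.
by apply: eq_bigr => b _; rewrite /ope !mxE.
Qed.

HB.instance Definition _ := GRing.isLinear.Build C 'M[C]_#|{: P}| 'M[C]_n _
  (@tr2 R n k) tr2_is_linear.

Lemma mxtrace_tr2 (M : 'M[C]_#|{: P}|) : \tr (tr2 M) = \tr M.
Proof.
rewrite mxtrace_ope /mxtrace; under eq_bigr => a _ do rewrite mxE.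
by rewrite pair_bigA; apply: eq_bigr => -[].
Qed.

Lemma mxtrace_Xt (X : 'M[C]_n) (M : 'M[C]_#|{: P}|) :
  \tr (Xt k X *m M) = \tr (X *m tr2 M).
Proof.
transitivity (\sum_a \sum_b \sum_a' X a a' * ope M (a', b) (a, b)); last first.
  apply: eq_bigr => a _; rewrite mxE exchange_big; apply: eq_bigr => a' _ /=.
  by rewrite mxE mulr_sumr.
rewrite mxtrace_ope [RHS]pair_bigA; apply: eq_bigr => -[a b] _ /=.
rewrite ope_mul.
transitivity (\sum_a' \sum_b' X a a' * ope M (a', b') (a, b) * (b' == b)%:R).
  rewrite [RHS]pair_bigA; apply: eq_bigr => -[a' b'] _ /=.
  by rewrite opmK /= mulrAC eq_sym.
by apply: eq_bigr => a' _; rewrite sum_mul_delta.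
Qed.

Definition coef_mx (v : 'cV[C]_#|{: P}|) : 'M[C]_(n, k) :=
  \matrix_(a, b) v (enum_rank (a, b)) 0.

Definition coef_vec (B : 'M[C]_(n, k)) : 'cV[C]_#|{: P}| :=
  \col_i B (enum_val i).1 (enum_val i).2.

Lemma coef_vecK : cancel coef_vec coef_mx.
Proof. by move=> B; apply/matrixP => a b; rewrite !mxE enum_rankK. Qed.

Lemma tr2_mulctrmx (v : 'cV[C]_#|{: P}|) :
  tr2 (v *m ctrmx v) = coef_mx v *m ctrmx (coef_mx v).
Proof.
apply/matrixP => a a'; rewrite mulmx_ctrmxE mxE; apply: eq_bigr => b _.
by rewrite /ope mulmx_ctrmxE big_ord1 !mxE.
Qed.

End PartialTrace.

Section Parties.
Variables n k : nat.
Local Notation P := ('I_n * 'I_k)%type.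

Lemma pcons0 N (s : P) (y : {ffun 'I_N -> P}) : pcons s y ord0 = s.
Proof. by rewrite ffunE unlift_none. Qed.

Lemma pconsS N (s : P) (y : {ffun 'I_N -> P}) j : pcons s y (lift ord0 j) = y j.
Proof. by rewrite ffunE liftK. Qed.

Definition ptail N (x : {ffun 'I_N.+1 -> P}) : {ffun 'I_N -> P} :=
  [ffun j => x (lift ord0 j)].

Lemma pcons_eta N (x : {ffun 'I_N.+1 -> P}) : pcons (x ord0) (ptail x) = x.
Proof.
by apply/ffunP => i; rewrite ffunE; case: unliftP => [j|] ->; rewrite ?ffunE.
Qed.

Lemma ptailK N (s : P) (y : {ffun 'I_N -> P}) : ptail (pcons s y) = y.
Proof. by apply/ffunP => j; rewrite ffunE pconsS. Qed.

Lemma sum_pcons (V : nmodType) N (F : {ffun 'I_N.+1 -> P} -> V) :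
  \sum_x F x = \sum_s \sum_y F (pcons s y).
Proof.
rewrite pair_bigA /=.
rewrite (reindex (fun p : P * {ffun 'I_N -> P} => pcons p.1 p.2)) //=.
exists (fun x : {ffun 'I_N.+1 -> P} => (x ord0, ptail x)) => [[s y] _|x _] /=.
  by rewrite pcons0 ptailK.
exact: pcons_eta.
Qed.

Definition pact N (s : 'S_N) (x : {ffun 'I_N -> P}) : {ffun 'I_N -> P} :=
  [ffun i => x (s i)].

Lemma pactM N (s t : 'S_N) x : pact s (pact t x) = pact (s * t)%g x.
Proof. by apply/ffunP => i; rewrite !ffunE permM. Qed.

Lemma pact1 N (x : {ffun 'I_N -> P}) : pact 1%g x = x.
Proof. by apply/ffunP => i; rewrite !ffunE perm1. Qed.

Lemma pactK N (s : 'S_N) : cancel (pact s) (pact s^-1%g).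
Proof. by move=> x; rewrite pactM mulVg pact1. Qed.

Lemma pactVK N (s : 'S_N) : cancel (pact s^-1%g) (pact s).
Proof. by move=> x; rewrite pactM mulgV pact1. Qed.

Lemma pact_pcons N (s : 'S_N) (z : P) x :
  pact (lift_perm ord0 ord0 s) (pcons z x) = pcons z (pact s x).
Proof.
apply/ffunP => i; rewrite ffunE; case: (unliftP ord0 i) => [j|] ->.
  by rewrite lift_perm_lift !pconsS ffunE.
by rewrite lift_perm_id !pcons0.
Qed.

Lemma pcons_swap N (z s : P) (y : {ffun 'I_N -> P}) :
  pcons z (pcons s y) =
  pact (tperm ord0 (lift ord0 ord0)) (pcons s (pcons z y)).
Proof.
apply/ffunP => i; rewrite [RHS]ffunE; case: tpermP => [->|->|].
- by rewrite pcons0 pconsS pcons0.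
- by rewrite pcons0 pconsS pcons0.
case: (unliftP ord0 i) => [j|] -> // _; rewrite !pconsS.
by case: (unliftP ord0 j) => [l|] -> // _; rewrite !pconsS.
Qed.

End Parties.

Section Blocks.
Variables (R : realType) (n k : nat).
Local Notation C := R[i].
Local Notation P := ('I_n * 'I_k)%type.
Local Notation op N := 'M[C]_#|{: {ffun 'I_N -> P}}|.

(* [Phi = \sum_(y, y') blockA Phi y y' (x) |y><y'|], the first factor being the
   first party. *)
Definition blockA N (Phi : op N.+1) (y y' : {ffun 'I_N -> P}) :
    'M[C]_#|{: P}| :=
  opm (fun s s' => ope Phi (pcons s y) (pcons s' y')).

Definition marg N (Phi : op N.+1) : 'M[C]_#|{: P}| := \sum_y blockA Phi y y.

Definition contractA N (v : 'cV[C]_#|{: P}|) (Phi : op N.+1) : op N :=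
  opm (fun y y' => qform (blockA Phi y y') v).

Lemma ope_blockA N (Phi : op N.+1) y y' s s' :
  ope (blockA Phi y y') s s' = ope Phi (pcons s y) (pcons s' y').
Proof. by rewrite opmK. Qed.

Lemma mxtrace_blockA N (Phi : op N.+1) y y' :
  \tr (blockA Phi y y') = \sum_s ope Phi (pcons s y) (pcons s y').
Proof. by rewrite mxtrace_ope; under eq_bigr do rewrite ope_blockA. Qed.

Lemma mxtrace_marg N (Phi : op N.+1) : \tr (marg Phi) = \tr Phi.
Proof.
rewrite raddf_sum /= mxtrace_ope sum_pcons [RHS]exchange_big.
by apply: eq_bigr => y _; rewrite mxtrace_blockA.
Qed.

Lemma mxtrace_contractA N v (Phi : op N.+1) :
  \tr (contractA v Phi) = qform (marg Phi) v.
Proof. by rewrite mxtrace_ope opmK qform_sum. Qed.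

Lemma mxtrace_XA N (X : 'M[C]_n) (Phi : op N.+1) :
  \tr (XA k N X *m Phi) = \tr (X *m tr2 (marg Phi)).
Proof.
rewrite -mxtrace_Xt mulmx_sumr raddf_sum /= mxtrace_ope sum_pcons.
under [RHS]eq_bigr do rewrite mxtrace_ope.
rewrite [RHS]exchange_big; apply: eq_bigr => s _; apply: eq_bigr => y _ /=.
rewrite !ope_mul sum_pcons; apply: eq_bigr => s' _; rewrite ope_blockA.
rewrite -[RHS](sum_mul_delta (fun y' => ope (Xt k X) s s' *
  ope Phi (pcons s' y') (pcons s y))); apply: eq_bigr => y' _.
rewrite opmK !pcons0 mulrAC; congr (_ * (nat_of_bool _)%:R).
apply/forallP/eqP => [yy'|-> j]; last by rewrite !pconsS.
by apply/ffunP => j; have /eqP := yy' j; rewrite !pconsS => ->.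
Qed.

Definition tensor_id N (v : 'cV[C]_#|{: P}|) :
    'M[C]_(#|{: {ffun 'I_N.+1 -> P}}|, #|{: {ffun 'I_N -> P}}|) :=
  \matrix_(i, j) let x : {ffun 'I_N.+1 -> P} := enum_val i in
    v (enum_rank (x ord0)) 0 * (ptail x == enum_val j)%:R.

Lemma tensor_idE N v s (y : {ffun 'I_N -> P}) j :
  tensor_id N v (enum_rank (pcons s y)) j =
  v (enum_rank s) 0 * (y == enum_val j)%:R.
Proof. by rewrite mxE /= enum_rankK pcons0 ptailK. Qed.

Lemma contractA_congr N v (Phi : op N.+1) :
  contractA v Phi = ctrmx (tensor_id N v) *m Phi *m tensor_id N v.
Proof.
have Phi_tensor_id s y j : (Phi *m tensor_id N v) (enum_rank (pcons s y)) j =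
    \sum_s' ope Phi (pcons s y) (pcons s' (enum_val j)) * v (enum_rank s') 0.
  rewrite mxE sum_enum_rank sum_pcons; apply: eq_bigr => s' _.
  rewrite -[RHS](sum_mul_delta (fun y' =>
    ope Phi (pcons s y) (pcons s' y') * _)).
  by apply: eq_bigr => y' _; rewrite tensor_idE mulrA.
apply/matrixP => i j; rewrite mxE qformE -mulmxA mxE.
rewrite !sum_enum_rank sum_pcons; apply: eq_bigr => s _.
transitivity (\sum_y (v (enum_rank s) 0)^* *
  (Phi *m tensor_id N v) (enum_rank (pcons s y)) j *
  (y == enum_val i)%:R); last first.
  apply: eq_bigr => y _; rewrite mulrAC; congr (_ * _).
  by rewrite ctrmxE tensor_idE rmorphM rmorph_nat.
rewrite sum_mul_delta Phi_tensor_id mulr_sumr sum_enum_rank.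
apply: eq_bigr => s' _.
by rewrite -[blockA _ _ _ _ _]/(ope (blockA _ _ _) s s') ope_blockA mulrA.
Qed.

Lemma psd_contractA N v (Phi : op N.+1) : psd Phi -> psd (contractA v Phi).
Proof. by move=> pPhi; rewrite contractA_congr; exact: psd_congr. Qed.

Lemma psd_blockA N (Phi : op N.+1) y : psd Phi -> psd (blockA Phi y y).
Proof.
pose f (i : 'I_#|{: P}|) := enum_rank (pcons (enum_val i) y).
by move=> /(psd_mxsub f); congr psd; apply/matrixP => i j; rewrite !mxE.
Qed.

Lemma psd_marg N (Phi : op N.+1) : psd Phi -> psd (marg Phi).
Proof. by move=> pPhi; apply: psd_sum => y; exact: psd_blockA. Qed.

End Blocks.

Section Bosonic.
Variables (R : realType) (n k : nat).
Local Notation C := R[i].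
Local Notation P := ('I_n * 'I_k)%type.
Local Notation op N := 'M[C]_#|{: {ffun 'I_N -> P}}|.

Definition bosonic N (Phi : op N) : Prop :=
  psd Phi /\ forall s x y, ope Phi (pact s x) y = ope Phi x y.

Lemma bosonic_pactr N (Phi : op N) s x y :
  bosonic Phi -> ope Phi x (pact s y) = ope Phi x y.
Proof.
move=> [[hPhi _] sPhi]; rewrite -[LHS](hermE hPhi) -[RHS](hermE hPhi).
by congr (_^*); exact: sPhi.
Qed.

Lemma bosonic_swapl N (Phi : op N.+2) s z y x : bosonic Phi ->
  ope Phi (pcons s (pcons z y)) x = ope Phi (pcons z (pcons s y)) x.
Proof. by move=> [_ sPhi]; rewrite pcons_swap sPhi. Qed.

Lemma bosonic_swap N (Phi : op N.+2) s z y s' z' y' : bosonic Phi ->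
  ope Phi (pcons s (pcons z y)) (pcons s' (pcons z' y')) =
  ope Phi (pcons z (pcons s y)) (pcons z' (pcons s' y')).
Proof.
by move=> bPhi; rewrite bosonic_swapl// (pcons_swap s') bosonic_pactr.
Qed.

Lemma bosonic_contractA N v (Phi : op N.+1) :
  bosonic Phi -> bosonic (contractA v Phi).
Proof.
move=> [pPhi sPhi]; split=> [|s x y]; first exact: psd_contractA.
rewrite !opmK; congr qform; apply: opeP => z z'.
by rewrite !ope_blockA -pact_pcons sPhi.
Qed.

Lemma bosonic_sum N (I : finType) (F : I -> op N) :
  (forall i, bosonic (F i)) -> bosonic (\sum_i F i).
Proof.
move=> bF; split=> [|s x y]; first by apply: psd_sum => i; case: (bF i).
by rewrite !ope_sum; apply: eq_bigr => i _; case: (bF i).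
Qed.

Lemma blockA_contractA N v (Phi : op N.+2) y y' : bosonic Phi ->
  blockA (contractA v Phi) y y' = \sum_i \sum_j ((v i 0)^* * v j 0) *:
    blockA Phi (pcons (enum_val i) y) (pcons (enum_val j) y').
Proof.
move=> bPhi; apply: opeP => s s'; rewrite ope_blockA opmK qformE ope_sum.
apply: eq_bigr => i _; rewrite ope_sum; apply: eq_bigr => j _.
by rewrite opeZ ope_blockA bosonic_swap// mulrAC mxE.
Qed.

Lemma trA_sum_contractA N (Phi : op N.+1) :
  trA Phi = \sum_i contractA (delta_mx i 0) Phi.
Proof.
apply: opeP => y y'; rewrite opmK ope_sum -mxtrace_blockA.
by apply: eq_bigr => i _; rewrite opmK qform_delta.
Qed.

Lemma marg_trA N (Phi : op N.+2) : bosonic Phi -> marg (trA Phi) = marg Phi.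
Proof.
move=> bPhi; apply: opeP => s s'; rewrite !ope_sum sum_pcons exchange_big.
apply: eq_bigr => y _; rewrite ope_blockA opmK; apply: eq_bigr => z _.
by rewrite ope_blockA bosonic_swap.
Qed.

(* The marginal of the first two parties, as a [#|P|]-by-[#|P|] array over the
   first party of operators on the second one. *)
Definition marg2 N (Phi : op N.+2) (i j : 'I_#|{: P}|) : 'M[C]_#|{: P}| :=
  \sum_y blockA Phi (pcons (enum_val i) y) (pcons (enum_val j) y).

Lemma marg_contractA N v (Phi : op N.+2) i j : bosonic Phi ->
  marg (contractA v Phi) i j = qform (marg2 Phi i j) v.
Proof.
move=> bPhi; rewrite summxE qform_sum; apply: eq_bigr => y _.
by rewrite mxE opmK.
Qed.

Lemma mxtrace_marg2 N (Phi : op N.+2) i j : bosonic Phi ->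
  \tr (marg2 Phi i j) = marg Phi i j.
Proof.
move=> bPhi; rewrite raddf_sum /= [RHS]summxE sum_pcons [RHS]exchange_big.
apply: eq_bigr => y _; rewrite mxtrace_blockA; apply: eq_bigr => s _.
by rewrite mxE bosonic_swap.
Qed.

Lemma marg2_swap N (Phi : op N.+2) i j l h : bosonic Phi ->
  marg2 Phi i j l h = marg2 Phi l j i h.
Proof.
move=> bPhi; rewrite !summxE; apply: eq_bigr => y _.
by rewrite !mxE bosonic_swapl.
Qed.

Definition polar_contractA N (Phi : op N.+1) b : op N :=
  contractA (polar_vec R b) Phi.

Local Notation frame_bound := (frame_bound R #|{: P}|).

Lemma sum_marg_polar_contractA N (Phi : op N.+2) : bosonic Phi ->
  \sum_b marg (polar_contractA Phi b) = frame_bound *: marg Phi.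
Proof.
move=> bPhi; apply/matrixP => i j; rewrite summxE mxE -(mxtrace_marg2 _ _ bPhi).
rewrite -sum_qform_polar_vec.
by apply: eq_bigr => b _; rewrite marg_contractA.
Qed.

Lemma sum_mxtrace_polar_contractA N (Phi : op N.+1) :
  \sum_b \tr (polar_contractA Phi b) = frame_bound * \tr Phi.
Proof.
rewrite -mxtrace_marg -sum_qform_polar_vec.
by apply: eq_bigr => b _; rewrite mxtrace_contractA.
Qed.

Lemma sum_linear_entropy_polar_contractA N (Phi : op N.+2) :
  \sum_b linear_entropy (marg (polar_contractA Phi b)) =
  frame_bound * \tr Phi - \sum_b purity (marg (polar_contractA Phi b)).
Proof.
rewrite sumrB -sum_mxtrace_polar_contractA.
by under eq_bigr do rewrite mxtrace_marg.
Qed.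

Lemma polar_swap_contractA N (Phi : op N.+2) : bosonic Phi ->
  polar_swap (fun b => marg (polar_contractA Phi b)) = 4%:R * \tr (marg Phi).
Proof.
move=> bPhi.
transitivity (polar_swap (fun b =>
    \matrix_(i, j) qform (marg2 Phi i j) (polar_vec R b))).
  by apply: eq_bigr => b _; rewrite mxE marg_contractA.
rewrite polar_swap_qform; congr (_ * _); apply: eq_bigr => i _.
rewrite -(mxtrace_marg2 _ _ bPhi); apply: eq_bigr => j _.
by rewrite marg2_swap.
Qed.

Lemma linear_entropy_marg_le N (Phi : op N.+2) e :
  bosonic Phi -> (0 < #|{: P}|)%N -> 0 < e ->
  linear_entropy (marg Phi) <= e * \tr Phi + gain_weight #|{: P}| e *
    (frame_bound^-1 * (\sum_b purity (marg (polar_contractA Phi b))) -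
     purity (marg Phi)).
Proof.
move=> bPhi P0 e0; have [pPhi _] := bPhi; rewrite -mxtrace_marg.
apply: linear_entropy_le_purity_gain => //.
- exact: psd_marg.
- by move=> b; apply: psd_marg; exact: psd_contractA.
- exact: sum_marg_polar_contractA.
- by move=> b; rewrite mxtrace_marg mxtrace_contractA.
- exact: polar_swap_contractA.
Qed.

End Bosonic.

Section SymmetricProjector.
Variables (R : realType) (n k : nat).
Local Notation C := R[i].
Local Notation P := ('I_n * 'I_k)%type.
Local Notation op N := 'M[C]_#|{: {ffun 'I_N -> P}}|.

Lemma ope_Vperm_mul N (s : 'S_N.+1) (M : op N.+1) x y :
  ope (Vperm R n k s *m M) x y = ope M (pact s^-1%g x) y.
Proof.
rewrite ope_mul -(sum_mul_delta (fun z => ope M z y)); apply: eq_bigr => z _.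
by rewrite opmK mulrC -/(pact s z) -(can2_eq (pactVK s) (pactK s)) eq_sym.
Qed.

Lemma ope_mul_Vperm N (s : 'S_N.+1) (M : op N.+1) x y :
  ope (M *m Vperm R n k s) x y = ope M x (pact s y).
Proof.
rewrite ope_mul -(sum_mul_delta (fun z => ope M x z)); apply: eq_bigr => z _.
by rewrite opmK.
Qed.

Lemma Vperm_Psym N (s : 'S_N.+1) : Vperm R n k s *m Psym R n k N = Psym R n k N.
Proof.
rewrite /Psym -scalemxAr mulmx_sumr; congr (_ *: _).
rewrite [RHS](reindex_inj (mulgI s)); apply: eq_bigr => t _; apply: opeP => x y.
rewrite ope_Vperm_mul !opmK -!/(pact _ _) -pactM.
by rewrite (can2_eq (pactVK s) (pactK s)).
Qed.

Lemma Psym_fixedP N (Phi : op N.+1) : psd Phi ->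
  Psym R n k N *m Phi *m Psym R n k N = Phi <-> bosonic Phi.
Proof.
move=> pPhi; split=> [PhiE|bPhi].
  have VPhi t : Vperm R n k t *m Phi = Phi.
    by rewrite -[in LHS]PhiE !mulmxA Vperm_Psym.
  by split=> // s x y; rewrite -[in RHS](VPhi s^-1%g) ope_Vperm_mul invgK.
have mean (a : C) : (N.+1)`!%:R^-1 * (\sum_(s : 'S_N.+1) a) = a.
  rewrite sumr_const card_Sn -[X in _ * X]mulr_natl.
  by rewrite mulKf ?pnatr_eq0 -?lt0n ?fact_gt0.
have -> : Psym R n k N *m Phi = Phi.
  apply: opeP => x y.
  rewrite -[RHS]mean /Psym -scalemxAl mulmx_suml opeZ ope_sum.
  by congr (_ * _); apply: eq_bigr => s _; rewrite ope_Vperm_mul; case: bPhi.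
apply: opeP => x y; rewrite -[RHS]mean /Psym -scalemxAr mulmx_sumr opeZ ope_sum.
by congr (_ * _); apply: eq_bigr => s _; rewrite ope_mul_Vperm bosonic_pactr.
Qed.

End SymmetricProjector.

Section TensorPowers.
Variables (R : realType) (n k : nat).
Local Notation C := R[i].
Local Notation P := ('I_n * 'I_k)%type.
Variable v : 'cV[C]_#|{: P}|.

Definition tensor_pow N : 'cV[C]_#|{: {ffun 'I_N -> P}}| :=
  \col_x \prod_j v (enum_rank ((enum_val x : {ffun 'I_N -> P}) j)) 0.

Definition pure_pow N : 'M[C]_#|{: {ffun 'I_N -> P}}| :=
  tensor_pow N *m ctrmx (tensor_pow N).

Lemma ope_pure_pow N x y :
  ope (pure_pow N) x y =
  \prod_j v (enum_rank (x j)) 0 * (\prod_j v (enum_rank (y j)) 0)^*.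
Proof. by rewrite /ope mulmx_ctrmxE big_ord1 !mxE !enum_rankK. Qed.

Lemma blockA_pure_pow N y y' :
  blockA (pure_pow N.+1) y y' = ope (pure_pow N) y y' *: (v *m ctrmx v).
Proof.
have prod_pcons s z : \prod_j v (enum_rank (pcons s z j)) 0 =
    v (enum_rank s) 0 * \prod_(j < N) v (enum_rank (z j)) 0.
  by rewrite big_ord_recl pcons0; under eq_bigr do rewrite pconsS.
apply: opeP => s s'; rewrite ope_blockA opeZ !ope_pure_pow !prod_pcons.
by rewrite rmorphM /= /ope mulmx_ctrmxE big_ord1; ring.
Qed.

Lemma marg_pure_pow N :
  marg (pure_pow N.+1) = \tr (pure_pow N) *: (v *m ctrmx v).
Proof.
rewrite mxtrace_ope scaler_suml.
by apply: eq_bigr => y _; rewrite blockA_pure_pow.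
Qed.

Lemma mxtrace_pure_pow N : \tr (v *m ctrmx v) = 1 -> \tr (pure_pow N) = 1.
Proof.
move=> v1; elim: N => [|N IH].
  rewrite mxtrace_ope.
  under eq_bigr do rewrite ope_pure_pow !big_ord0 rmorph1 mulr1.
  by rewrite sumr_const card_ffun card_ord expn0.
by rewrite -mxtrace_marg marg_pure_pow mxtraceZ v1 IH mulr1.
Qed.

Lemma bosonic_pure_pow N : bosonic (pure_pow N).
Proof.
split=> [|s x y]; first exact: psd_mulctrmx.
rewrite !ope_pure_pow [in RHS](reindex_inj (@perm_inj _ s)); congr (_ * _).
by apply: eq_bigr => j _; rewrite ffunE.
Qed.

End TensorPowers.

Section Hierarchy.
Variables (R : realType) (n m k : nat).
Local Notation C := R[i].
Local Notation P := ('I_n * 'I_k)%type.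
Local Notation op N := 'M[C]_#|{: {ffun 'I_N -> P}}|.
Variables (Lam : {linear 'M[C]_n -> 'M[C]_m}) (Y : 'M[C]_m).

(* The homogeneous form of [Lam (tr2 M) = Y] at [\tr M = 1]. *)
Definition compatible (M : 'M[C]_#|{: P}|) : Prop := Lam (tr2 M) = \tr M *: Y.

Lemma compatibleZ a M : compatible M -> compatible (a *: M).
Proof. by rewrite /compatible !linearZ /= => ->; rewrite scalerA. Qed.

Lemma compatible_sum (I : finType) (F : I -> 'M[C]_#|{: P}|) :
  (forall i, compatible (F i)) -> compatible (\sum_i F i).
Proof.
move=> cF; rewrite /compatible !linear_sum scaler_suml; apply: eq_bigr => i _.
exact: cF.
Qed.

Definition sdp_cone N (Phi : op N.+1) : Prop :=
  bosonic Phi /\ forall y y', compatible (blockA Phi y y').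

Lemma LamA_kronYP N (Phi : op N.+1) :
  LamA Lam Phi = kronY Y (trA Phi) <->
  forall y y', compatible (blockA Phi y y').
Proof.
rewrite /compatible; split=> [E y y'|E].
  apply/matrixP => i i'.
  have := congr1 (fun A => ope A (i, y) (i', y')) E.
  by rewrite !opmK /= mxE mxtrace_blockA mulrC.
apply: opeP => -[i y] [i' y']; rewrite !opmK /=.
by rewrite /Lamt -/(blockA Phi y y') E mxE mxtrace_blockA mulrC.
Qed.

Lemma sdp_feasibleP N (Phi : op N.+1) :
  sdp_feasible Lam Y Phi <-> sdp_cone Phi /\ \tr Phi = 1.
Proof.
split=> [[pPhi tr1 sPhi /LamA_kronYP cPhi]|[[bPhi /LamA_kronYP cPhi] tr1]].
  by split=> //; split=> //; exact/Psym_fixedP.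
by have [pPhi _] := bPhi; split=> //; exact/Psym_fixedP.
Qed.

Lemma sdp_cone_sum N (I : finType) (F : I -> op N.+1) :
  (forall i, sdp_cone (F i)) -> sdp_cone (\sum_i F i).
Proof.
move=> cF; split=> [|y y']; first by apply: bosonic_sum => i; case: (cF i).
have -> : blockA (\sum_i F i) y y' = \sum_i blockA (F i) y y'.
  apply: opeP => s s'; rewrite ope_blockA !ope_sum.
  by apply: eq_bigr => i _; rewrite ope_blockA.
by apply: compatible_sum => i; case: (cF i).
Qed.

Lemma sdp_cone_contractA N v (Phi : op N.+2) :
  sdp_cone Phi -> sdp_cone (contractA v Phi).
Proof.
move=> [bPhi cPhi]; split=> [|y y']; first exact: bosonic_contractA.
rewrite blockA_contractA//; apply: compatible_sum => i.
by apply: compatible_sum => j; exact: compatibleZ.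
Qed.

Lemma sdp_cone_trA N (Phi : op N.+2) : sdp_cone Phi -> sdp_cone (trA Phi).
Proof.
move=> cPhi; rewrite trA_sum_contractA; apply: sdp_cone_sum => i.
exact: sdp_cone_contractA.
Qed.

Lemma compatible_marg N (Phi : op N.+1) : sdp_cone Phi -> compatible (marg Phi).
Proof. by move=> [_ cPhi]; exact: compatible_sum. Qed.

Lemma sdp_cone_pure_pow N v :
  compatible (v *m ctrmx v) -> sdp_cone (pure_pow v N.+1).
Proof.
move=> cv; split=> [|y y']; first exact: bosonic_pure_pow.
by rewrite blockA_pure_pow; exact: compatibleZ.
Qed.

Variable X : 'M[C]_n.

Lemma xi_le_xi_hier N : (xi k X Lam Y <= xi_hier k X Lam Y N)%E.
Proof.
apply: ge_ereal_sup => _ [rho [rhoY tr1 prho rk] <-].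
have [B rhoE] := psd_rank_factor prho rk; pose v := coef_vec B.
have vE : tr2 (v *m ctrmx v) = rho by rewrite tr2_mulctrmx coef_vecK -rhoE.
have v1 : \tr (v *m ctrmx v) = 1 by rewrite -mxtrace_tr2 vE.
apply: ereal_sup_ubound; exists (pure_pow v N.+1).
  apply/sdp_feasibleP; rewrite mxtrace_pure_pow//; split=> //.
  by apply: sdp_cone_pure_pow; rewrite /compatible vE v1 scale1r.
by rewrite mxtrace_XA marg_pure_pow mxtrace_pure_pow// scale1r vE.
Qed.

Lemma xi_hier_nonincreasing N :
  (xi_hier k X Lam Y N.+1 <= xi_hier k X Lam Y N)%E.
Proof.
apply: ge_ereal_sup => _ [Phi /sdp_feasibleP[cPhi tr1] <-].
have [bPhi _] := cPhi.
apply: ereal_sup_ubound; exists (trA Phi); last by rewrite !mxtrace_XA marg_trA.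
apply/sdp_feasibleP; split; first exact: sdp_cone_trA.
by rewrite -mxtrace_marg marg_trA// mxtrace_marg.
Qed.

Definition objective (M : 'M[C]_#|{: P}|) : R := complex.Re (\tr (X *m tr2 M)).

Lemma pure_le_xi (M : 'M[C]_#|{: P}|) :
  psd M -> \tr M = 1 -> \tr (M *m M) = 1 -> compatible M ->
  ((objective M)%:E <= xi k X Lam Y)%E.
Proof.
move=> pM tr1 pure1; rewrite /compatible tr1 scale1r => cM.
apply: ereal_sup_ubound; exists (tr2 M) => //.
have [v ME] := pure_rank1 pM tr1 pure1.
split=> //; first by rewrite mxtrace_tr2.
  by rewrite ME tr2_mulctrmx; exact: psd_mulctrmx.
rewrite ME tr2_mulctrmx.
exact: leq_trans (mxrankM_maxl _ _) (rank_leq_col _).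
Qed.

End Hierarchy.

Section RealImaginaryParts.
Variable R : rcfType.
Implicit Types x y : R[i].

Lemma ler_Re x y : x <= y -> complex.Re x <= complex.Re y.
Proof. by rewrite lecE => /andP[]. Qed.

Lemma ReM x y : complex.Re (x * y) =
  complex.Re x * complex.Re y - complex.Im x * complex.Im y.
Proof. by case: x y => [a b] []. Qed.

Lemma ReM_ge0 x y : 0 <= x -> complex.Re (x * y) = complex.Re x * complex.Re y.
Proof. by move=> x0; rewrite ReM (ger0_Im x0) mul0r subr0. Qed.

Lemma ImM x y : complex.Im (x * y) =
  complex.Re x * complex.Im y + complex.Im x * complex.Re y.
Proof. by case: x y => [a b] []. Qed.

End RealImaginaryParts.

Section ComplexLimits.
Variables (R : realType) (I : Type) (F : set_system I).
Context {FF : ProperFilter F}.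
Local Notation C := R[i].
Implicit Types z w : I -> C.

Definition cvgC (z : I -> C) (l : C) :=
  (complex.Re (z t) @[t --> F] --> complex.Re l) /\
  (complex.Im (z t) @[t --> F] --> complex.Im l).

Lemma cvgC_cst a : cvgC (fun=> a) a.
Proof. by split; exact: cvg_cst. Qed.

Lemma cvgCD z w a b : cvgC z a -> cvgC w b -> cvgC (fun t => z t + w t) (a + b).
Proof.
move=> [za za'] [wb wb']; split; rewrite raddfD.
  by under eq_fun do rewrite raddfD; exact: cvgD.
by under eq_fun do rewrite raddfD; exact: cvgD.
Qed.

Lemma cvgCM z w a b : cvgC z a -> cvgC w b -> cvgC (fun t => z t * w t) (a * b).
Proof.
move=> [za za'] [wb wb']; split.
  by rewrite ReM; under eq_fun do rewrite ReM; apply: cvgB; exact: cvgM.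
by rewrite ImM; under eq_fun do rewrite ImM; apply: cvgD; exact: cvgM.
Qed.

Lemma cvgC_conj z a : cvgC z a -> cvgC (fun t => (z t)^*) a^*.
Proof.
have Re_conj (x : C) : complex.Re x^* = complex.Re x by case: x.
have Im_conj (x : C) : complex.Im x^* = - complex.Im x by case: x.
move=> [za za']; split.
  by rewrite Re_conj; under eq_fun do rewrite Re_conj.
by rewrite Im_conj; under eq_fun do rewrite Im_conj; exact: cvgN.
Qed.

Lemma cvgC_sum (J : Type) (r : seq J) (z : J -> I -> C) (a : J -> C) :
  (forall j, cvgC (z j) (a j)) ->
  cvgC (fun t => \sum_(j <- r) z j t) (\sum_(j <- r) a j).
Proof.
move=> za; elim: r => [|j r IH].
  by rewrite big_nil; under eq_fun do rewrite big_nil; exact: cvgC_cst.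
by rewrite big_cons; under eq_fun do rewrite big_cons; exact: cvgCD.
Qed.

Lemma cvgC_unique z a b : cvgC z a -> cvgC z b -> a = b.
Proof.
move=> [za za'] [zb zb']; apply/eqP; rewrite eq_complex.
rewrite (cvg_unique (@norm_hausdorff _ _) za zb).
by rewrite (cvg_unique (@norm_hausdorff _ _) za' zb') !eqxx.
Qed.

Lemma cvgC_ge0 z a : cvgC z a -> (forall t, 0 <= z t) -> 0 <= a.
Proof.
move=> [za za'] z0; rewrite lecE; apply/andP; split.
  have : complex.Im (z t) @[t --> F] --> 0.
    by under eq_fun do rewrite ger0_Im//; exact: cvg_cst.
  by move/(cvg_unique (@norm_hausdorff _ _) za') => ->.
apply: cvgr_to_ge za _; apply: filterE => t.
exact: (ler_Re (z0 t)).
Qed.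

Definition cvg_entries p q (A : I -> 'M[C]_(p, q)) (L : 'M[C]_(p, q)) :=
  forall i j, cvgC (fun t => A t i j) (L i j).

Lemma cvg_entries_cst p q (L : 'M[C]_(p, q)) : cvg_entries (fun=> L) L.
Proof. by move=> i j; exact: cvgC_cst. Qed.

Lemma cvg_entriesM p q r (A : I -> 'M[C]_(p, q)) (B : I -> 'M[C]_(q, r)) L M :
  cvg_entries A L -> cvg_entries B M ->
  cvg_entries (fun t => A t *m B t) (L *m M).
Proof.
move=> AL BM i j; rewrite mxE; under eq_fun do rewrite mxE.
by apply: cvgC_sum => l; exact: cvgCM.
Qed.

Lemma cvgC_mxtrace d (A : I -> 'M[C]_d) L :
  cvg_entries A L -> cvgC (fun t => \tr (A t)) (\tr L).
Proof. by move=> AL; exact: cvgC_sum. Qed.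

Lemma cvg_entries_linear p q p' q' (f : {linear 'M[C]_(p, q) -> 'M[C]_(p', q')})
    (A : I -> 'M[C]_(p, q)) L :
  cvg_entries A L -> cvg_entries (fun t => f (A t)) (f L).
Proof.
have fE M i j : f M i j = \sum_a \sum_b M a b * f (delta_mx a b) i j.
  rewrite {1}(matrix_sum_delta M) linear_sum summxE; apply: eq_bigr => a _.
  by rewrite linear_sum summxE; apply: eq_bigr => b _; rewrite linearZ mxE.
move=> AL i j; rewrite fE; under eq_fun do rewrite fE.
apply: cvgC_sum => a; apply: cvgC_sum => b.
by apply: cvgCM => //; exact: cvgC_cst.
Qed.

Lemma cvg_entries_unique p q (A : I -> 'M[C]_(p, q)) L M :
  cvg_entries A L -> cvg_entries A M -> L = M.
Proof.
by move=> AL AM; apply/matrixP => i j; exact: cvgC_unique (AL i j) (AM i j).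
Qed.

Lemma cvg_entries_psd d (A : I -> 'M[C]_d) L :
  cvg_entries A L -> (forall t, psd (A t)) -> psd L.
Proof.
move=> AL pA; split=> [|v].
  apply: (@cvg_entries_unique _ _ A) => // i j.
  rewrite ctrmxE; have -> : (fun t => A t i j) = fun t => (A t j i)^*.
    by apply/funext => t; rewrite hermE//; case: (pA t).
  exact: cvgC_conj.
apply: (@cvgC_ge0 (fun t => qform (A t) v)); last first.
  by move=> t; have [_] := pA t; exact.
have : cvg_entries (fun t => ctrmx v *m A t *m v) (ctrmx v *m L *m v).
  by do 2?[apply: cvg_entriesM => //; try exact: cvg_entries_cst].
exact.
Qed.

Lemma cvgC_linear_entropy d (A : I -> 'M[C]_d) L :
  cvg_entries A L -> \tr L = 1 -> (forall t, \tr (A t) = 1) ->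
  cvgC (fun t => linear_entropy (A t)) (linear_entropy L).
Proof.
move=> AL trL trA; rewrite linear_entropy_normalized// -mulN1r.
under eq_fun do rewrite linear_entropy_normalized// -mulN1r.
apply: cvgCD; first exact: cvgC_cst.
apply: cvgCM; first exact: cvgC_cst.
by apply: cvgC_mxtrace; exact: cvg_entriesM.
Qed.

End ComplexLimits.

Section UltraLimits.
Variables (R : realType) (I : Type) (U : set_system I).
Context {UU : UltraFilter U}.
Local Notation C := R[i].

Lemma ultra_bounded_cvg (u : I -> R) (M : R) :
  (forall t, `|u t| <= M) -> exists l : R, u @ U --> l.
Proof.
move=> uM; have [|l [_ ul]] := @segment_compact R (- M) M (u @ U) _.
  suff : U (u @^-1` `[- M, M]) by [].
  by apply: filterE => t; rewrite /= in_itv /= -ler_norml.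
exists l => A lA; have [//|nA] := in_ultra_setVsetC (u @^-1` A) UU.
by have [x []] := ul (~` A) A nA lA.
Qed.

Lemma ultra_bounded_cvgC (z : I -> C) (M : R) :
  (forall t, `|z t| <= M%:C%C) -> exists l, cvgC U z l.
Proof.
move=> zM.
have [a aP] : exists a : R, complex.Re (z t) @[t --> U] --> a.
  apply: (@ultra_bounded_cvg _ M) => t.
  by rewrite -lecR; apply: le_trans (normc_ge_Re _) (zM t).
have [b bP] : exists b : R, complex.Im (z t) @[t --> U] --> b.
  apply: (@ultra_bounded_cvg _ M) => t; rewrite -normrN -ReiNIm -lecR.
  apply: le_trans (normc_ge_Re _) _; rewrite normrM complexiE normCi mulr1.
  exact: zM.
by exists (Complex a b).
Qed.

Lemma ultra_psd_cvg d (A : I -> 'M[C]_d) :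
  (forall t, psd (A t)) -> (forall t, \tr (A t) = 1) ->
  exists L, [/\ cvg_entries U A L, psd L & \tr L = 1].
Proof.
move=> pA tr1.
have /choice[l lP] (ij : 'I_d * 'I_d) :
    exists l, cvgC U (fun t => A t ij.1 ij.2) l.
  apply: (@ultra_bounded_cvgC _ 1) => t; have [hA _] := pA t.
  rewrite rmorph1 -(@expr_le1 _ 2)//.
  apply: le_trans (herm_entry_sqr_le _ _ hA) _.
  by apply: le_trans (psd_mxtrace_sqr_le (pA t)) _; rewrite tr1 expr1n.
pose L : 'M[C]_d := \matrix_(i, j) l (i, j).
have AL : cvg_entries U A L by move=> i j; rewrite mxE; exact: (lP (i, j)).
exists L; split=> //; first exact: cvg_entries_psd AL pA.
apply: (@cvgC_unique _ _ U _ (fun t => \tr (A t))); first exact: cvgC_mxtrace.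
by under eq_fun do rewrite tr1; exact: cvgC_cst.
Qed.

End UltraLimits.

Lemma cvg_succ_mul_le (R : realType) (F : set_system nat) {FF : ProperFilter F}
    (a g : nat -> R) (l h : R) : \oo `<=` F -> a @ F --> l -> g @ F --> h ->
  (forall j, 0 <= g j) -> (forall j, j.+1%:R * g j <= a j) -> 0 <= l /\ h = 0.
Proof.
move=> oF al gh g0 ga; split.
  apply: cvgr_to_ge al _; apply: filterE => j.
  by apply: le_trans (ga j); rewrite mulr_ge0.
apply/eqP; rewrite eq_le; apply/andP; split; last first.
  by apply: cvgr_to_ge gh _; exact: filterE.
have : a j * j.+1%:R^-1 @[j --> F] --> l * 0.
  by apply: cvgM => //; exact: cvg_trans (cvg_app _ oF) (@cvg_harmonic R).
rewrite mulr0 => /(ler_cvg_to gh); apply; apply: filterE => j.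
by rewrite ler_pdivlMr// mulrC.
Qed.

Section PurityGap.
Variables (R : realType) (n m k : nat).
Local Notation C := R[i].
Local Notation P := ('I_n * 'I_k)%type.
Variables (Lam : {linear 'M[C]_n -> 'M[C]_m}) (Y : 'M[C]_m) (X : 'M[C]_n).
Implicit Types A : 'M[C]_#|{: P}|.

Local Notation objective := (objective X).

Lemma cvg_objective (I : Type) (F : set_system I) {FF : ProperFilter F}
    (A : I -> 'M[C]_#|{: P}|) L :
  cvg_entries F A L -> objective (A t) @[t --> F] --> objective L.
Proof.
move=> AL.
have [] // : cvgC F (fun t => \tr (X *m tr2 (A t))) (\tr (X *m tr2 L)).
apply: cvgC_mxtrace; apply: cvg_entriesM; first exact: cvg_entries_cst.
exact: cvg_entries_linear.
Qed.

Lemma cvg_entries_compatible (I : Type) (F : set_system I) {FF : ProperFilter F}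
    (A : I -> 'M[C]_#|{: P}|) L :
  cvg_entries F A L -> \tr L = 1 -> (forall t, \tr (A t) = 1) ->
  (forall t, compatible Lam Y (A t)) -> compatible Lam Y L.
Proof.
move=> AL trL trA cA; rewrite /compatible trL scale1r.
apply: (@cvg_entries_unique _ _ F _ _ _ (fun t => Lam (tr2 (A t)))).
  by apply: cvg_entries_linear; exact: cvg_entries_linear.
have -> : (fun t => Lam (tr2 (A t))) = fun=> Y; last exact: cvg_entries_cst.
by apply/funext => t; rewrite (cA t) trA scale1r.
Qed.

(* Otherwise, an ultralimit of counterexamples for [K -> oo] is a pure
   feasible point of value at least [t]. *)
Lemma purity_gap_normalized t : (xi k X Lam Y < t%:E)%E -> exists2 K, 0 <= K &
  forall A, psd A -> \tr A = 1 -> compatible Lam Y A ->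
    objective A - t <= K * complex.Re (linear_entropy A).
Proof.
move=> xt; apply/not_exists2P => noK.
have {noK} /choice[A /all_and4[pA tr1 cA entropyA]] (j : nat) :
    exists A, [/\ psd A, \tr A = 1, compatible Lam Y A &
    j.+1%:R * complex.Re (linear_entropy A) <= objective A - t].
  have [/negP|] := noK j.+1%:R; first by rewrite ler0n.
  move=> /existsNP[A /not_implyP[pA /not_implyP[tr1 /not_implyP[cA /negP]]]].
  by rewrite -ltNge => /ltW; exists A.
have [U [UU oU]] := ultraFilterLemma (eventually_filter).
have [L [AL pL trL]] := ultra_psd_cvg pA tr1.
have cL : compatible Lam Y L by exact: cvg_entries_compatible AL trL tr1 cA.
have XL : objective (A j) - t @[j --> U] --> objective L - t.
  by apply: cvgB; [exact: cvg_objective|exact: cvg_cst].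
have [entropyL _] := cvgC_linear_entropy AL trL tr1.
have entropy_ge0 j : 0 <= complex.Re (linear_entropy (A j)).
  exact: (ler_Re (linear_entropy_ge0 (pA j))).
have [tX Re_entropyL] := cvg_succ_mul_le oU XL entropyL entropy_ge0 entropyA.
have pureL : \tr (L *m L) = 1.
  have := RRe_real (ger0_real (linear_entropy_ge0 pL)).
  rewrite Re_entropyL rmorph0 linear_entropy_normalized// => /esym/eqP.
  by rewrite subr_eq0 => /eqP.
have := pure_le_xi X pL trL pureL cL; apply/negP; rewrite -ltNge.
by apply: lt_le_trans xt _; rewrite lee_fin -subr_ge0.
Qed.

Lemma objective_sum (s : seq 'M[C]_#|{: P}|) :
  objective (\sum_(A <- s) A) = \sum_(A <- s) objective A.
Proof.
rewrite /objective [tr2 _]linear_sum /= mulmx_sumr.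
by rewrite [\tr _]raddf_sum /= raddf_sum.
Qed.

Lemma objectiveZ a A :
  0 <= a -> objective (a *: A) = complex.Re a * objective A.
Proof.
by move=> a0; rewrite /objective linearZ /= -scalemxAr mxtraceZ ReM_ge0.
Qed.

Lemma purity_gap t : (xi k X Lam Y < t%:E)%E -> exists2 K, 0 <= K &
  forall A, psd A -> compatible Lam Y A ->
    objective A - t * complex.Re (\tr A) <= K * complex.Re (linear_entropy A).
Proof.
move=> /purity_gap_normalized[K K0 gap]; exists K => // A pA cA.
have [tr0|tr0] := eqVneq (\tr A) 0.
  have A0 : A = 0 *: A by rewrite scale0r; exact: psd_mxtrace_eq0.
  rewrite A0 objectiveZ// linear_entropyZ mxtraceZ.
  by rewrite !mul0r raddf0 !mulr0 subrr.
have tr_ge0 := psd_mxtrace_ge0 pA; pose A1 := (\tr A)^-1 *: A.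
have AE : A = \tr A *: A1 by rewrite scalerA mulfV// scale1r.
have objE : objective A = complex.Re (\tr A) * objective A1.
  by rewrite -objectiveZ// -AE.
have entE : complex.Re (linear_entropy A) =
    complex.Re (\tr A) * complex.Re (linear_entropy A1).
  by rewrite -ReM_ge0// -linear_entropyZ -AE.
rewrite objE entE (mulrC t) -mulrBr mulrCA ler_wpM2l//.
  exact: (ler_Re tr_ge0).
apply: gap; last exact: compatibleZ.
  by apply: psdZ => //; rewrite invr_ge0.
by rewrite mxtraceZ mulVf.
Qed.

End PurityGap.

Lemma lee_fin_upper (R : realFieldType) (x y : \bar R) :
  (forall t, (y < t%:E)%E -> (x <= t%:E)%E) -> (x <= y)%E.
Proof.
case: y => [y||] ub; last 2 first.
- exact: leey.
- case: x ub => [x||] ub //; last by have := ub 0 (ltNyr _).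
  by have := ub (x - 1) (ltNyr _); rewrite lee_fin lerBrDr gerDl ler10.
apply/lee_addgt0Pr => e e0; rewrite -EFinD; apply: ub.
by rewrite lte_fin ltrDl.
Qed.

Section DeFinetti.
Variables (R : realType) (n m k : nat).
Local Notation C := R[i].
Local Notation P := ('I_n * 'I_k)%type.
Local Notation op N := 'M[C]_#|{: {ffun 'I_N -> P}}|.
Variables (Lam : {linear 'M[C]_n -> 'M[C]_m}) (Y : 'M[C]_m).

Definition mixture (M : 'M[C]_#|{: P}|) (delta : C) : Prop :=
  exists s : seq 'M[C]_#|{: P}|,
    [/\ forall A, A \in s -> psd A /\ compatible Lam Y A, \sum_(A <- s) A = M
      & \sum_(A <- s) linear_entropy A <= delta].

Lemma mixture0 : mixture 0 0.
Proof. by exists [::]; rewrite !big_nil. Qed.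

Lemma mixture1 M : psd M -> compatible Lam Y M -> mixture M (linear_entropy M).
Proof.
move=> pM cM; exists [:: M]; rewrite !big_seq1; split=> // A.
by rewrite inE => /eqP ->.
Qed.

Lemma mixtureD M M' delta delta' :
  mixture M delta -> mixture M' delta' -> mixture (M + M') (delta + delta').
Proof.
move=> [s [sP <- sd]] [s' [sP' <- sd']]; exists (s ++ s').
rewrite !big_cat; split=> //; last exact: lerD.
by move=> A; rewrite mem_cat => /orP[/sP|/sP'].
Qed.

Lemma mixtureZ a M delta :
  0 <= a -> mixture M delta -> mixture (a *: M) (a * delta).
Proof.
move=> a0 [s [sP <- sd]]; exists [seq a *: A | A <- s]; rewrite !big_map; split.
- move=> _ /mapP[A /sP[pA cA] ->]; split; first exact: psdZ.
  exact: compatibleZ.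
- by rewrite scaler_sumr.
- by under eq_bigr do rewrite linear_entropyZ; rewrite -mulr_sumr ler_wpM2l.
Qed.

Lemma mixture_sum (I : Type) (r : seq I) (M : I -> 'M[C]_#|{: P}|)
    (delta : I -> C) :
  (forall i, mixture (M i) (delta i)) ->
  mixture (\sum_(i <- r) M i) (\sum_(i <- r) delta i).
Proof.
by move=> mix; elim/big_ind2: _ => // *; [exact: mixture0|exact: mixtureD].
Qed.

Lemma mixture_le M delta delta' :
  delta <= delta' -> mixture M delta -> mixture M delta'.
Proof.
by move=> dd [s [sP sM sd]]; exists s; split=> //; exact: le_trans sd dd.
Qed.

Hypothesis P_gt0 : (0 < #|{: P}|)%N.
Local Notation frame_bound := (frame_bound R #|{: P}|).
Local Notation gain_weight := (@gain_weight R #|{: P}|).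

Lemma mixture_polar_contractA N (Phi : op N.+2) a (delta : _ -> C) :
  bosonic Phi ->
  (forall b, mixture (a *: marg (polar_contractA Phi b)) (delta b)) ->
  mixture (a *: marg Phi) (frame_bound^-1 * \sum_b delta b).
Proof.
move=> bPhi mix; have D0 := frame_bound_gt0 R P_gt0.
have -> : a *: marg Phi =
    frame_bound^-1 *: \sum_b a *: marg (polar_contractA Phi b).
  rewrite -scaler_sumr sum_marg_polar_contractA// !scalerA mulrCA.
  by rewrite mulVf ?mulr1 ?lt0r_neq0.
by apply: mixtureZ; [rewrite invr_ge0 ltW|exact: mixture_sum].
Qed.

(* The gains of purity along the contractions telescope. *)
Lemma marg_mixture N (Phi : op N.+1) e : 0 < e -> sdp_cone Lam Y Phi ->
  mixture (N%:R *: marg Phi)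
          (N%:R * (e * \tr Phi) + gain_weight e * linear_entropy (marg Phi)).
Proof.
move=> e0; elim: N Phi => [|N IH] Phi cPhi; have [bPhi _] := cPhi;
  have pM := psd_marg (proj1 bPhi).
  rewrite scale0r mul0r add0r; apply: mixture_le mixture0.
  by rewrite mulr_ge0 ?linear_entropy_ge0// gain_weight_ge0.
have mixN := mixture_polar_contractA bPhi
  (fun b => IH _ (sdp_cone_contractA (polar_vec R b) cPhi)).
have := mixtureD (mixture1 pM (compatible_marg cPhi)) mixN.
rewrite -[X in X + _]scale1r -scalerDl nat1r; apply: mixture_le.
apply: le_trans (lerD (linear_entropy_marg_le bPhi P_gt0 e0) (lexx _)) _.
rewrite big_split /= -!mulr_sumr sum_mxtrace_polar_contractA.
rewrite sum_linear_entropy_polar_contractA le_eqVlt; apply/predU1P; left.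
rewrite /linear_entropy mxtrace_marg -[N.+1%:R]natr1.
have := lt0r_neq0 (frame_bound_gt0 R P_gt0).
by move: frame_bound (\sum_b purity _) => c G c0; field.
Qed.

Lemma de_finetti (e : R) : 0 < e -> exists N, forall Phi : op N.+1,
  sdp_cone Lam Y Phi -> \tr Phi = 1 -> mixture (marg Phi) e%:C%C.
Proof.
move=> e0; pose h : C := (e / 2)%:C%C.
have h0 : 0 < h by rewrite ltcR divr_gt0.
pose N := (Num.truncn (complex.Re (gain_weight h) / (e / 2))).+1.
have weight_le : gain_weight h <= N%:R * h.
  rewrite -[leLHS]RRe_real ?ger0_real ?gain_weight_ge0//.
  rewrite -(rmorph_nat (real_complex R)) -rmorphM lecR.
  by rewrite -ler_pdivrMr ?divr_gt0// ltW// truncnS_gt.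
exists N => Phi cPhi tr1; have [[pPhi _] _] := cPhi.
have N0 : N%:R != 0 :> C by rewrite pnatr_eq0.
have -> : marg Phi = N%:R^-1 *: (N%:R *: marg Phi).
  by rewrite scalerA mulVf ?scale1r.
have -> : e%:C%C = N%:R^-1 * (N%:R * (h + h)).
  by rewrite mulKf// -rmorphD -splitr.
apply: mixtureZ; first by rewrite invr_ge0 ler0n.
apply: mixture_le (marg_mixture h0 cPhi).
have entropy_le1 : linear_entropy (marg Phi) <= 1.
  rewrite /linear_entropy mxtrace_marg tr1 gerBl purity_ge0//.
  exact: psd_marg.
rewrite tr1 mulr1 [leRHS]mulrDr lerD2l; apply: le_trans weight_le.
by rewrite ler_piMr ?gain_weight_ge0.
Qed.

Lemma mixture_objective_le (X : 'M[C]_n) t K (M : 'M[C]_#|{: P}|) delta :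
  0 <= K ->
  (forall A : 'M[C]_#|{: P}|, psd A -> compatible Lam Y A ->
    objective X A - t * complex.Re (\tr A) <=
    K * complex.Re (linear_entropy A)) ->
  mixture M delta ->
  objective X M - t * complex.Re (\tr M) <= K * complex.Re delta.
Proof.
move=> K0 gap [s [sP <- sd]].
rewrite objective_sum [\tr _]raddf_sum /= raddf_sum mulr_sumr -sumrB.
apply: le_trans (_ : \sum_(A <- s) K * complex.Re (linear_entropy A) <= _).
  by rewrite !big_seq; apply: ler_sum => A /sP[pA cA]; exact: gap.
by rewrite -mulr_sumr -raddf_sum ler_wpM2l//; exact: ler_Re.
Qed.

Lemma exists_xi_hier_le (X : 'M[C]_n) (t u : R) :
  (xi k X Lam Y < t%:E)%E -> t < u ->
  exists N, (xi_hier k X Lam Y N <= u%:E)%E.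
Proof.
move=> /purity_gap[K K0 gap] tu; have K1 : 0 < K + 1 by rewrite ltr_wpDl.
have [|N mix] := @de_finetti ((u - t) / (K + 1)).
  by rewrite divr_gt0 ?subr_gt0.
exists N; apply: ge_ereal_sup => _ [Phi /sdp_feasibleP[cPhi tr1] <-].
rewrite lee_fin mxtrace_XA -/(objective X _) -(lerD2r (- t)).
have := mixture_objective_le K0 gap (mix _ cPhi tr1).
rewrite mxtrace_marg tr1 mulr1 => /le_trans; apply.
by rewrite /= mulrCA ler_piMr ?subr_ge0 ?(ltW tu)// ler_pdivrMr// mul1r lerDl.
Qed.

Lemma ereal_inf_xi_hier_le (X : 'M[C]_n) :
  (ereal_inf (range (xi_hier k X Lam Y)) <= xi k X Lam Y)%E.
Proof.
apply: lee_fin_upper => t xt; apply: lee_fin_upper => u; rewrite lte_fin => tu.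
have [N NP] := exists_xi_hier_le xt tu; apply: le_trans NP.
by apply: ereal_inf_lbound; exists N.
Qed.

End DeFinetti.

Theorem theorem2 (R : realType) (n m k : nat)
  (X : 'M[R[i]]_n) (Lam : {linear 'M[R[i]]_n -> 'M[R[i]]_m}) (Y : 'M[R[i]]_m) :
  (0 < n)%N -> (0 < m)%N -> (0 < k)%N -> herm X ->
  [/\ (forall N : nat, (xi k X Lam Y <= xi_hier k X Lam Y N)%E),
      (forall N : nat, (xi_hier k X Lam Y N.+1 <= xi_hier k X Lam Y N)%E)
    & (xi_hier k X Lam Y N @[N --> \oo] --> xi k X Lam Y)].
Proof.
move=> n0 _ k0 _; have P0 : (0 < #|{: 'I_n * 'I_k}|)%N.
  by rewrite card_prod !card_ord muln_gt0 n0.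
split; [exact: xi_le_xi_hier|exact: xi_hier_nonincreasing|].
have -> : xi k X Lam Y = ereal_inf (range (xi_hier k X Lam Y)).
  apply/eqP; rewrite eq_le ereal_inf_xi_hier_le// andbT.
  by apply: le_ereal_inf_tmp => _ [N _ <-]; exact: xi_le_xi_hier.
apply: ereal_nonincreasing_cvgn; apply/nonincreasing_seqP => N.
exact: xi_hier_nonincreasing.
Qed.
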